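(* Let $f:X\to Y$ be a continuous map between compacta $X$ and $Y$. Then $Mf(MEX)\subset MEY$; that is, $Mf$ sends every exact capacity on $X$ to an exact capacity on $Y$.
   Context: A compactum is a compact Hausdorff space. For a compactum $X$, $\mathcal F(X)$ denotes the family of all closed subsets of $X$ (including $\emptyset$). A capacity (upper-semicontinuous capacity) on $X$ is a function $\nu:\mathcal F(X)\to[0,1]$ such that for all closed $F,G\subset X$: (1) $\nu(X)=1$, $\nu(\emptyset)=0$; (2) if $F\subset G$ then $\nu(F)\le\nu(G)$; (3) if $\nu(F)<a$ then there exists an open set $O\supset F$ such that $\nu(B)<a$ for each compact $B\subset O$. A capacity is extended to open sets $U\subset X$ by $\nu(U)=\sup\{\nu(K)\mid K \text{ closed in } X,\ K\subset U\}$. $MX$ is the set of all capacities on $X$, with the topology whose subbase consists of all sets $O_-(F,a)=\{c\in MX\mid c(F)<a\}$ ($F\subset X$ closed, $a\in[0,1]$) and $O_+(U,a)=\{c\in MX\mid c(U)>a\}$ ($U\subset X$ open, $a\in[0,1]$). For a continuous map of compacta $f:X\to Y$, the map $Mf:MX\to MY$ is defined by $Mf(\nu)(A)=\nu(f^{-1}(A))$ for $\nu\in MX$, $A\in\mathcal F(Y)$. $PX$ is the set of all $\sigma$-additive regular Borel probability measures on $X$; identifying a measure with its restriction to $\mathcal F(X)$, one has $PX\subset MX$, and $PX$ carries the subspace topology. $cc(PX)$ is the set of all nonempty closed convex subsets of $PX$. The map $sX:cc(PX)\to MX$ is defined by $sX(\alpha)(A)=\inf\{\mu(A)\mid\mu\in\alpha\}$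 for $\alpha\in cc(PX)$, $A\in\mathcal F(X)$. A capacity $\nu\in MX$ is called exact if $\nu\in sX(cc(PX))$, i.e. $\nu=sX(\alpha)$ for some $\alpha\in cc(PX)$. $MEX\subset MX$ denotes the set of exact capacities on $X$ (and $MEY$ that on $Y$). *)

(* Defs.v *)
(* MathComp-Analysis; the real numbers are an arbitrary [R : realType]. *)
From HB Require Import structures.
From mathcomp Require Import all_boot all_order all_algebra.
From mathcomp Require Import all_classical all_reals all_analysis.

Set Implicit Arguments.
Unset Strict Implicit.
Unset Printing Implicit Defensive.

Import Order.TTheory GRing.Theory Num.Theory.
Import numFieldNormedType.Exports.

Local Open Scope classical_set_scope.
Local Open Scope ring_scope.

(* A compactum may be empty. *)
HB.mixin Record isCompactHausdorff T & Topological T := {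
  compactT : compact [set: T] ;
  hausdorffT : hausdorff_space T
}.

#[short(type="compactumType")]
HB.structure Definition Compactum :=
  {T of Topological T & isCompactHausdorff T}.

Record closed_set (X : topologicalType) := ClosedSet {
  closed_carrier :> set X ;
  closed_setP : closed closed_carrier
}.

Definition closed_set0 (X : topologicalType) : closed_set X :=
  ClosedSet (@closed0 X).
Definition closed_setT (X : topologicalType) : closed_set X :=
  ClosedSet (@closedT X).

Definition closed_preimage (X Y : topologicalType) (f : X -> Y)
    (cf : continuous f) (A : closed_set Y) : closed_set X :=
  ClosedSet ((continuous_closedP f).1 cf _ (@closed_setP _ A)).

(* In a compactum the compact sets are exactly the closed ones, so the "compact
   B" of upper semicontinuity ranges over [closed_set X]. *)
Record capacity (R : realType) (X : compactumType) := Capacity {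
  cap_val :> closed_set X -> R ;
  cap_itv : forall A, 0 <= cap_val A <= 1 ;
  capT : cap_val (closed_setT X) = 1 ;
  cap0 : cap_val (closed_set0 X) = 0 ;
  cap_mono : forall F G : closed_set X, F `<=` G -> cap_val F <= cap_val G ;
  cap_usc : forall (F : closed_set X) (a : R), cap_val F < a ->
    exists O : set X, [/\ open O, F `<=` O &
      forall B : closed_set X, B `<=` O -> cap_val B < a]
}.

HB.instance Definition _ (R : realType) (X : compactumType) :=
  gen_eqMixin (capacity R X).
HB.instance Definition _ (R : realType) (X : compactumType) :=
  gen_choiceMixin (capacity R X).

Definition cap_open (R : realType) (X : compactumType) (nu : capacity R X)
    (U : set X) : R :=
  sup [set nu K | K in [set K : closed_set X | K `<=` U]].

Definition cap_subbase (R : realType) (X : compactumType) :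
    set (set (capacity R X)) :=
  [set [set c : capacity R X | c Fa.1 < Fa.2] |
    Fa in [set Fa : closed_set X * R | 0 <= Fa.2 <= 1]] `|`
  [set [set c : capacity R X | cap_open c Ua.1 > Ua.2] |
    Ua in [set Ua : set X * R | open Ua.1 /\ 0 <= Ua.2 <= 1]].

HB.instance Definition _ (R : realType) (X : compactumType) :=
  isSubBaseTopological.Build (capacity R X) (@cap_subbase R X) id.

Section capacity_map.
Variables (R : realType) (X Y : compactumType) (f : X -> Y).
Hypothesis cf : continuous f.
Variable nu : capacity R X.

Let Mf (A : closed_set Y) : R := nu (closed_preimage cf A).

Let Mf_itv A : 0 <= Mf A <= 1.
Proof. exact: cap_itv. Qed.

Let MfT : Mf (closed_setT Y) = 1.
Proof.
apply/eqP; rewrite eq_le; have /andP[_ ->] := Mf_itv (closed_setT Y).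
by rewrite /= -(capT nu); apply: cap_mono.
Qed.

Let Mf0 : Mf (closed_set0 Y) = 0.
Proof.
apply/eqP; rewrite eq_le; have /andP[-> _] := Mf_itv (closed_set0 Y).
by rewrite andbT -(cap0 nu); apply: cap_mono.
Qed.

Let Mf_mono (F G : closed_set Y) : F `<=` G -> Mf F <= Mf G.
Proof. by move=> FG; apply: cap_mono => x /=; exact: FG. Qed.

Let Mf_usc (F : closed_set Y) (a : R) : Mf F < a ->
  exists O : set Y, [/\ open O, F `<=` O &
    forall B : closed_set Y, B `<=` O -> Mf B < a].
Proof.
move=> /cap_usc[V [oV FV Va]]; exists (~` (f @` (~` V))); split.
- apply: closed_openC; apply: compact_closed; first exact: hausdorffT.
  apply: continuous_compact; first exact: continuous_subspaceT.
  apply: (subclosed_compact _ (@compactT X)) => //.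
  exact: open_closedC.
- by move=> y Fy [x Vx fxy]; apply: Vx; apply: FV => /=; rewrite fxy.
- move=> B BV; apply: Va => x /= /BV Bfx.
  by apply: contrapT => nVx; apply: Bfx; exists x.
Qed.

Definition capacity_map : capacity R Y :=
  Capacity Mf_itv MfT Mf0 Mf_mono Mf_usc.

End capacity_map.

(* Measurable types are pointed in the library. The base point [x0] only serves
   to provide that structure, and is irrelevant to the Borel sets; an empty
   compactum has no base point, and carries no probability either. *)
Definition pointed_at (X : topologicalType) (x0 : X) : Type := X.

HB.instance Definition _ (X : topologicalType) (x0 : X) :=
  Choice.on (pointed_at x0).
HB.instance Definition _ (X : topologicalType) (x0 : X) :=
  isPointed.Build (pointed_at x0) x0.

Definition borel (X : topologicalType) (x0 : X) : Type :=
  g_sigma_algebraType (@open X : set (set (pointed_at x0))).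

Definition regular_measure (R : realType) (X : compactumType) (x0 : X)
    (mu : {measure set (borel x0) -> \bar R}) : Prop :=
  forall B : set (borel x0), measurable B ->
    mu B = ereal_sup [set mu K | K in [set K : set X | closed K /\ K `<=` B]] /\
    mu B = ereal_inf [set mu U | U in [set U : set X | open U /\ B `<=` U]].

Section restriction.
Variables (R : realType) (X : compactumType) (x0 : X).
Variable mu : probability (borel x0) R.
Hypothesis reg : regular_measure mu.

Let r (A : closed_set X) : R := fine (mu A).

Let mO (U : set X) : open U -> measurable (U : set (borel x0)).
Proof. by move=> oU; apply: sub_gen_smallest. Qed.

Let mC (A : closed_set X) : measurable ((A : set X) : set (borel x0)).
Proof.
rewrite -[X in measurable X]setCK; apply: measurableC; apply: mO.
by apply: closed_openC; exact: closed_setP.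
Qed.

Let muE (A : closed_set X) : mu A = (r A)%:E.
Proof. by rewrite fineK// fin_num_measure. Qed.

Let r_itv A : 0 <= r A <= 1.
Proof. by rewrite -!lee_fin -muE measure_ge0 probability_le1. Qed.

Let rT : r (closed_setT X) = 1.
Proof. by rewrite /r probability_setT. Qed.

Let r0 : r (closed_set0 X) = 0.
Proof. by rewrite /r measure0. Qed.

Let r_mono (F G : closed_set X) : F `<=` G -> r F <= r G.
Proof.
by move=> FG; rewrite -lee_fin -!muE le_measure// inE; exact: mC.
Qed.

Let r_usc (F : closed_set X) (a : R) : r F < a ->
  exists O : set X, [/\ open O, F `<=` O &
    forall B : closed_set X, B `<=` O -> r B < a].
Proof.
rewrite -lte_fin -muE (reg (mC F)).2 => /ereal_inf_lt[_ [U [oU FU] <-] Ua].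
exists U; split=> // B BU; rewrite -lte_fin -muE.
by apply: le_lt_trans Ua; rewrite le_measure// inE; [exact: mC|exact: mO].
Qed.

Definition restriction : capacity R X := Capacity r_itv rT r0 r_mono r_usc.

End restriction.

Definition prob_capacity (R : realType) (X : compactumType) :
    set (capacity R X) :=
  [set nu | exists (x0 : X) (mu : probability (borel x0) R)
              (reg : regular_measure mu), nu = restriction reg].

(* [PX], with the subspace topology that [set_type] carries. *)
Definition prob (R : realType) (X : compactumType) : topologicalType :=
  set_type (@prob_capacity R X).

(* A regular measure being determined by its values on closed sets, convex
   combinations are those of functions on closed sets. *)
Definition cc (R : realType) (X : compactumType) : set (set (prob R X)) :=
  [set al | [/\ al !=set0, closed al &
     convex_set [set (cap_val (set_val m) : closed_set X -> R^o) | m in al]]].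

Section envelope.
Variables (R : realType) (X : compactumType) (al : set (prob R X)).
Hypothesis cc_al : cc al.

Let s (A : closed_set X) : R := inf [set set_val m A | m in al].

Let s_lb A : has_lbound [set set_val m A | m in al].
Proof. by exists 0 => _ [m _ <-]; have /andP[] := cap_itv (set_val m) A. Qed.

Let s_neq0 A : [set set_val m A | m in al] !=set0.
Proof. by have [[m alm] _ _] := cc_al; exists (set_val m A), m. Qed.

Let s_le m A : al m -> s A <= set_val m A.
Proof. by move=> alm; apply: ge_inf; [exact: s_lb|exists m]. Qed.

Let s_itv A : 0 <= s A <= 1.
Proof.
apply/andP; split.
  apply: lb_le_inf; first exact: s_neq0.
  by move=> _ [m _ <-]; have /andP[] := cap_itv (set_val m) A.
have [[m alm] _ _] := cc_al; apply: le_trans (s_le A alm) _.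
by have /andP[] := cap_itv (set_val m) A.
Qed.

Let sT : s (closed_setT X) = 1.
Proof.
apply/eqP; rewrite eq_le; have /andP[_ ->] := s_itv (closed_setT X) => /=.
apply: lb_le_inf; first exact: s_neq0.
by move=> _ [m _ <-]; rewrite capT.
Qed.

Let s0 : s (closed_set0 X) = 0.
Proof.
apply/eqP; rewrite eq_le; have /andP[-> _] := s_itv (closed_set0 X).
have [[m alm] _ _] := cc_al.
by rewrite andbT -(cap0 (set_val m)); exact: s_le.
Qed.

Let s_mono (F G : closed_set X) : F `<=` G -> s F <= s G.
Proof.
move=> FG; apply: lb_le_inf; first exact: s_neq0.
move=> _ [m alm <-].
by apply: le_trans (s_le F alm) _; exact: cap_mono.
Qed.

Let s_usc (F : closed_set X) (a : R) : s F < a ->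
  exists O : set X, [/\ open O, F `<=` O &
    forall B : closed_set X, B `<=` O -> s B < a].
Proof.
move=> /(inf_lt (s_neq0 F))[_ [m alm <-]].
move=> /cap_usc[V [oV FV Va]]; exists V; split=> // B /Va.
by apply: le_lt_trans; exact: s_le.
Qed.

Definition envelope : capacity R X := Capacity s_itv sT s0 s_mono s_usc.

End envelope.

Definition exact_capacity (R : realType) (X : compactumType) :
    set (capacity R X) :=
  [set nu | exists (al : set (prob R X)) (cc_al : cc al), nu = envelope cc_al].

(* Main.v *)
Require Import Defs.
From HB Require Import structures.
From mathcomp Require Import all_boot all_order all_algebra.
From mathcomp Require Import all_classical all_reals all_analysis.
From mathcomp Require Import lra.
Local Open Scope classical_set_scope.

(** Let [nu] be the lower envelope of a closed convex set [al] of regular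
    probabilities on [X]. The image of [al] under push-forward along [f] is a
    convex set whose lower envelope is [capacity_map cf nu], but that it is
    closed is usually deduced from the compactness of the space of regular
    probabilities. Compactness can be avoided by using instead the core of
    [capacity_map cf nu], that is the set of all the regular probabilities on
    [Y] that dominate it.

    The core of any capacity is closed ([core_closed]), because each condition
    of the form [m A < a] defines a subbasic open set, and it is convex
    ([core_convex]), because domination is preserved by mixtures. Hence a
    capacity is exact as soon as it is the pointwise infimum of a nonempty part
    of its core ([exact_of_dominating]). The push-forwards of the members of
    [al] form such a part for [capacity_map cf nu].

    What remains is measure theory: push-forwards and mixtures of regular Borel
    probabilities are regular ([prob_capacity_map], [prob_capacity_mixture]).
    Both follow from a characterization of regularity by inner approximation
    alone ([inner_approx_regular]). *)

Set Implicit Arguments.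
Unset Strict Implicit.
Unset Printing Implicit Defensive.

Import Order.TTheory GRing.Theory Num.Theory.
Local Open Scope ring_scope.

(** * Borel sets and capacities *)

Lemma open_borel (X : topologicalType) (x0 : X) (U : set X) :
  open U -> measurable (U : set (borel x0)).
Proof. by move=> oU; apply: sub_gen_smallest. Qed.

Lemma closed_borel (X : topologicalType) (x0 : X) (A : set X) :
  closed A -> measurable (A : set (borel x0)).
Proof.
move=> cA; rewrite -[X in measurable X]setCK; apply: measurableC.
by apply: open_borel; exact: closed_openC.
Qed.

Lemma continuous_borel (X Y : topologicalType) (f : X -> Y) (x0 : X) (y0 : Y) :
  continuous f -> measurable_fun setT (f : borel x0 -> borel y0).
Proof.
move=> /continuousP cf; apply: (@measurability _ _ (borel x0) (borel y0) _ _
  (@open Y : set (set (pointed_at y0)))) => //.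
by move=> _ [U oU <-]; rewrite setTI; apply: open_borel; exact: cf.
Qed.

Lemma probability_fin d (T : measurableType d) (R : realType)
    (P : probability T R) (A : set T) :
  measurable A -> exists r : R, P A = r%:E.
Proof.
by move=> mA; exists (fine (P A)); rewrite fineK// fin_num_measure.
Qed.

Arguments closed_borel {X} x0 {A}.
Arguments continuous_borel {X Y f} x0 y0.

Lemma capacity_ext (R : realType) (X : compactumType) (nu nu' : capacity R X) :
  (forall A, nu A = nu' A) -> nu = nu'.
Proof.
move=> eq_nu; have {}eq_nu : cap_val nu = cap_val nu' by exact: funext.
case: nu nu' eq_nu => [v ? ? ? ? ?] [v' ? ? ? ? ?] /= vv'.
by subst v'; congr Capacity; exact: Prop_irrelevance.
Qed.

(** * Regularity by inner approximation *)

Section inner_approximation.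
Variables (R : realType) (X : compactumType) (x0 : X).
Variable mu : probability (borel x0) R.
Local Open Scope ereal_scope.

Definition inner_approx := forall (B : set (borel x0)) (e : R),
  measurable B -> (0 < e)%R ->
  exists K : set X, [/\ closed K, K `<=` B & mu B <= mu K + e%:E].

(** Outer approximation is inner approximation of the complement, since the
    total mass is finite. *)
Lemma inner_approx_regular : inner_approx -> regular_measure mu.
Proof.
move=> app B mB; split; apply/eqP; rewrite eq_le; apply/andP; split.
- apply/lee_addgt0Pr => e e0; have [K [cK KB BK]] := app B e mB e0.
  apply: le_trans BK _; rewrite leeD2r//.
  by apply: ereal_sup_ubound; exists K.
- apply: ge_ereal_sup => _ [K [cK KB] <-].
  by rewrite le_measure// inE//; exact: closed_borel.
- apply: le_ereal_inf_tmp => _ [U [oU BU] <-].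
  by rewrite le_measure// inE//; exact: open_borel.
- apply/lee_addgt0Pr => e e0.
  have [K [cK KB BK]] := app (~` B) e (measurableC mB) e0.
  have mK : measurable (K : set (borel x0)) by exact: closed_borel.
  have CK : mu (~` K) <= mu B + e%:E.
    move: BK; rewrite !probability_setC//.
    have [b ->] := probability_fin mu mB; have [k ->] := probability_fin mu mK.
    by rewrite -[1]/(1%:E) -!EFinD !lee_fin; lra.
  apply: le_trans CK; apply: ereal_inf_lbound; exists (~` K) => //; split.
    exact: closed_openC.
  by move=> x Bx /KB; exact.
Qed.

Lemma regular_inner_approx : regular_measure mu -> inner_approx.
Proof.
move=> reg B e mB e0; have [supB _] := reg B mB.
have finB : mu B \is a fin_num by exact: fin_num_measure.
have [|_ [K [cK KB] <-]] := @ub_ereal_sup_adherent R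
    [set mu K | K in [set K : set X | closed K /\ K `<=` B]] e e0.
  by rewrite -supB.
rewrite -supB => BK; exists K; split=> //.
by rewrite -leeBlDr// ltW.
Qed.

End inner_approximation.

Lemma prob_capacityI (R : realType) (X : compactumType) (x0 : X)
    (mu : probability (borel x0) R) (nu : capacity R X) :
  inner_approx mu -> (forall A, nu A = fine (mu A)) -> prob_capacity nu.
Proof.
move=> app nuE; exists x0, mu, (inner_approx_regular app).
exact: capacity_ext.
Qed.

(** * Push-forwards *)

(** A closed set inside the preimage of [B] has a compact, hence closed, image
    inside [B]. The base point of [Y] is free, so that the identity of [X]
    transports a probability from one base point to another. *)
Lemma pushforward_inner_approx (R : realType) (X Y : compactumType) (f : X -> Y)
    (x0 : X) (y0 : Y) (mu : probability (borel x0) R) :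
  continuous f -> inner_approx mu ->
  exists2 P : probability (borel y0) R, inner_approx P &
    forall B, P B = mu (f @^-1` B).
Proof.
move=> cf app; have mf := continuous_borel x0 y0 cf.
pose F : {mfun borel x0 >-> borel y0} :=
  HB.pack (f : borel x0 -> borel y0) (isMeasurableFun.Build _ _ _ _ _ mf).
exists (distribution mu F) => // B e mB e0.
have mfB : measurable (f @^-1` B : set (borel x0)).
  by rewrite -[X in measurable X]setTI; exact: (mf measurableT).
have [K [cK KB BK]] := app _ _ mfB e0.
have cfK : closed (f @` K).
  apply: compact_closed; first exact: hausdorffT.
  apply: continuous_compact; first exact: continuous_subspaceT.
  exact: subclosed_compact (@compactT X) _.
exists (f @` K); split=> //; first by move=> _ [x Kx <-]; exact: KB.
apply: (le_trans BK); rewrite leeD2r// le_measure// ?inE.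
- exact: closed_borel.
- by rewrite -[X in measurable X]setTI; apply: (mf measurableT); exact: closed_borel.
- exact: preimage_image.
Qed.

Lemma prob_capacity_map (R : realType) (X Y : compactumType) (f : X -> Y)
    (cf : continuous f) (nu : capacity R X) :
  prob_capacity nu -> prob_capacity (capacity_map cf nu).
Proof.
move=> [x0 [mu [reg ->]]].
have [P appP PE] :=
  pushforward_inner_approx (f x0) cf (regular_inner_approx reg).
by apply: (prob_capacityI appP) => A; rewrite PE.
Qed.

(** * Mixtures *)

Section mixture.
Context d (T : measurableType d) (R : realType).
Variables (t : {i01 R}) (P Q : probability T R).

Definition mixture : set T -> \bar R :=
  measure_add (mscale t%:num%:nng P) (mscale (1 - t%:num)%:nng Q).

HB.instance Definition _ := Measure.on mixture.

Lemma mixtureE A :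
  mixture A = (t%:num%:E * P A + (1 - t%:num)%:E * Q A)%E.
Proof. by rewrite /mixture measure_addE. Qed.

Let mixtureT : mixture setT = 1%E.
Proof. by rewrite mixtureE !probability_setT !mule1 -EFinD subrKC. Qed.

HB.instance Definition _ := Measure_isProbability.Build _ _ _ mixture mixtureT.

End mixture.

(** The union of inner approximations for [P] and [Q] approximates for both. *)
Lemma mixture_inner_approx (R : realType) (X : compactumType) (x0 : X)
    (t : {i01 R}) (P Q : probability (borel x0) R) :
  inner_approx P -> inner_approx Q -> inner_approx (mixture t P Q).
Proof.
move=> appP appQ B e mB e0.
have [K [cK KB BK]] := appP B e mB e0; have [L [cL LB BL]] := appQ B e mB e0.
have mK : measurable (K : set (borel x0)) by exact: closed_borel.
have mL : measurable (L : set (borel x0)) by exact: closed_borel.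
have mKL : measurable (K `|` L : set (borel x0)) by exact: measurableU.
exists (K `|` L); split; first exact: closedU.
  by rewrite subUset.
have {}BK : (P B <= P (K `|` L) + e%:E)%E.
  by apply: (le_trans BK); rewrite leeD2r// le_measure// inE.
have {}BL : (Q B <= Q (K `|` L) + e%:E)%E.
  by apply: (le_trans BL); rewrite leeD2r// le_measure// inE.
rewrite /= !mixtureE; move: BK BL.
have [p ->] := probability_fin P mB; have [q ->] := probability_fin Q mB.
have [p' ->] := probability_fin P mKL; have [q' ->] := probability_fin Q mKL.
rewrite -!EFinM -!EFinD !lee_fin => BK BL.
have t0 : 0 <= t%:num :> R by [].
have t1 : 0 <= 1 - t%:num :> R by [].
have := ler_wpM2l t0 BK; have := ler_wpM2l t1 BL; lra.
Qed.

(** Two probabilities may come with different base points; the second one is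
    moved to the base point of the first one before mixing. *)
Lemma prob_capacity_mixture (R : realType) (X : compactumType) (t : {i01 R})
    (nu1 nu2 : capacity R X) :
  prob_capacity nu1 -> prob_capacity nu2 ->
  exists2 nu : capacity R X, prob_capacity nu &
    forall A, nu A = t%:num * nu1 A + (1 - t%:num) * nu2 A.
Proof.
move=> [x1 [P [regP ->]]] [x2 [Q' [regQ' ->]]].
have [Q appQ QE] := pushforward_inner_approx x1 (fun x => @cvg_id _ (nbhs x))
  (regular_inner_approx regQ').
have app := mixture_inner_approx t (regular_inner_approx regP) appQ.
exists (restriction (inner_approx_regular app)).
  by exists x1, (mixture t P Q), (inner_approx_regular app).
move=> A; have mA := closed_borel x1 (@closed_setP _ A).
rewrite /= mixtureE fineD ?fin_numM ?fin_num_measure//.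
by rewrite !fineM ?fin_num_measure//= QE.
Qed.

(** * The core of a capacity *)

Lemma open_capacity_lt (R : realType) (X : compactumType) (A : closed_set X)
    (a : R) : 0 <= a <= 1 -> open [set c : capacity R X | c A < a].
Proof.
move=> a01; exists [set [set c : capacity R X | c A < a]].
  move=> _ ->; apply: finI_from1; left; by exists (A, a).
by rewrite bigcup_set1.
Qed.

Section core.
Variables (R : realType) (X : compactumType) (nu : capacity R X).

Definition core : set (prob R X) :=
  [set m : prob R X | forall A : closed_set X, nu A <= set_val m A].

Lemma core_closed : closed core.
Proof.
have -> : core = \bigcap_(A in [set: closed_set X])
    set_val @^-1` [set c : capacity R X | nu A <= c A].
  by apply/seteqP; split=> [m cm A _|m cm A]; exact: cm.
apply: closed_bigI => A _.
apply: (continuous_closedP _).1; first exact: initial_continuous.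
rewrite (_ : [set _ | _] = ~` [set c : capacity R X | c A < nu A]).
  apply: open_closedC; apply: open_capacity_lt; exact: cap_itv.
by apply/seteqP; split=> c /=; rewrite leNgt => /negP.
Qed.

Lemma core_convex :
  convex_set [set (cap_val (set_val m) : closed_set X -> R^o) | m in core].
Proof.
move=> _ _ t /set_mem[m1 c1 <-] /set_mem[m2 c2 <-]; apply/mem_set.
have [nu' pnu' nu'E] := prob_capacity_mixture t (set_valP m1) (set_valP m2).
exists (SigSub (mem_set pnu')); last first.
  by apply/funext => A; exact: nu'E.
move=> A /=; rewrite nu'E.
have t0 : 0 <= t%:num :> R by [].
have t1 : 0 <= 1 - t%:num :> R by [].
have := ler_wpM2l t0 (c1 A); have := ler_wpM2l t1 (c2 A); lra.
Qed.

(** Every member of the core lies above [nu], so adding the whole core to [D]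
    does not change the infimum. *)
Lemma exact_of_dominating (D : set (prob R X)) :
  D !=set0 -> D `<=` core ->
  (forall A, nu A = inf [set set_val m A | m in D]) -> exact_capacity nu.
Proof.
move=> [m0 Dm0] Dcore nuE.
have cc_core : cc core.
  by split; [exists m0; exact: Dcore|exact: core_closed|exact: core_convex].
exists core, cc_core; apply: capacity_ext => A /=.
apply/eqP; rewrite eq_le; apply/andP; split.
  apply: lb_le_inf; first by exists (set_val m0 A), m0 => //; exact: Dcore.
  by move=> _ [m cm <-]; exact: cm.
rewrite nuE; apply: lb_le_inf; first by exists (set_val m0 A), m0.
move=> _ [m Dm <-]; apply: ge_inf; last by exists m => //; exact: Dcore.
by exists (nu A) => _ [m' cm' <-]; exact: cm'.
Qed.

End core.

Theorem lemma3 (R : realType) (X Y : compactumType) (f : X -> Y)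
    (cf : continuous f) :
  capacity_map cf @` @exact_capacity R X `<=` @exact_capacity R Y.
Proof.
move=> _ [_ [al [cc_al ->]] <-].
pose push (m : prob R X) : prob R Y :=
  SigSub (mem_set (prob_capacity_map cf (set_valP m))).
have [[m0 alm0] _ _] := cc_al.
apply: (@exact_of_dominating _ _ _ (push @` al)).
- by exists (push m0), m0.
- move=> _ [m alm <-] A /=; apply: ge_inf; last by exists m.
  by exists 0 => _ [m' _ <-]; have /andP[] :=
    cap_itv (set_val m') (closed_preimage cf A).
- move=> A /=; congr inf; apply/seteqP; split=> [_ [m alm <-]|_ [_ [m alm <-] <-]].
    by exists (push m) => //; exists m.
  by exists m.
Qed.
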